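(* Let $R_1,R_2$ be commutative rings with identity, $f:R_1\to R_2$ a ring homomorphism, $J$ an ideal of $R_2$, $M$ an $R_1$-module, $N$ an $R_2$-module (regarded as an $R_1$-module via $f$), and $\varphi:M\to N$ an $R_1$-module homomorphism. Let $F$ be a submodule of $M$ and let $N_2$ be an $(f(R_1)+J)$-submodule of $\varphi(M)+JN$. Then: (1) $F\bowtie^{\varphi}JN$ is a 2-absorbing submodule of the $(R_1\bowtie^{f}J)$-module $M\bowtie^{\varphi}JN$ if and only if $F$ is a 2-absorbing submodule of the $R_1$-module $M$. (2) $\overline{N_2}^{\varphi}$ is a 2-absorbing submodule of the $(R_1\bowtie^{f}J)$-module $M\bowtie^{\varphi}JN$ if and only if $N_2$ is a 2-absorbing submodule of the $(f(R_1)+J)$-module $\varphi(M)+JN$.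
   Context: All rings are commutative with identity and all modules are unital. For a submodule $F$ of an $R$-module $M$, $(F:_R M)=\{r\in R: rM\subseteq F\}$. A proper submodule $F$ of an $R$-module $M$ is called 2-absorbing if whenever $a,b\in R$, $m\in M$ and $abm\in F$, then $ab\in(F:_R M)$ or $am\in F$ or $bm\in F$. The amalgamation of rings is the subring $R_1\bowtie^{f}J=\{(r,f(r)+j): r\in R_1,\ j\in J\}$ of $R_1\times R_2$. The amalgamation of $M$ and $N$ along $J$ with respect to $\varphi$ is $M\bowtie^{\varphi}JN=\{(m,\varphi(m)+n): m\in M,\ n\in JN\}$, an $(R_1\bowtie^{f}J)$-module under $(r,f(r)+j)\cdot(m,\varphi(m)+n)=(rm,\varphi(rm)+f(r)n+j\varphi(m)+jn)$. For a submodule $F$ of $M$, $F\bowtie^{\varphi}JN=\{(m,\varphi(m)+n): m\in F,\ n\in JN\}$. For an $(f(R_1)+J)$-submodule $N_2$ of $\varphi(M)+JN$, $\overline{N_2}^{\varphi}=\{(m,\varphi(m)+n)\in M\bowtie^{\varphi}JN: \varphi(m)+n\in N_2\}$. Both are submodules of $M\bowtie^{\varphi}JN$. Here $f(R_1)+J$ is a subring of $R_2$ and $\varphi(M)+JN$ is an $(f(R_1)+J)$-module. *)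

(* Defs.v *)
From HB Require Import structures.
From mathcomp Require Import all_boot all_order all_algebra.
From mathcomp Require Import boolp.

Set Implicit Arguments.
Unset Strict Implicit.
Unset Printing Implicit Defensive.

Import GRing.Theory.
Local Open Scope ring_scope.

(* The zero ring is a commutative ring with identity, so rings are
   [comPzRingType]s. Subsets are boolean predicates; through the classical
   [`[< _ >]] of boolp these are arbitrary subsets. *)

Section TwoAbsorbing.
Variables (R : comPzRingType) (M : lmodType R).

Definition colon (F : {pred M}) : {pred R} :=
  [pred r | `[< forall m : M, r *: m \in F >]].

Definition proper_submod (F : {pred M}) : Prop :=
  submod_closed F /\ exists m : M, m \notin F.

Definition two_absorbing (F : {pred M}) : Prop :=
  proper_submod F /\
  forall (a b : R) (m : M), (a * b) *: m \in F ->
    [\/ a * b \in colon F, a *: m \in F | b *: m \in F].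

End TwoAbsorbing.

Lemma submodB (R : pzRingType) (V : lmodType R) (S : submodClosed V) :
  {in S &, forall u v, u - v \in S}.
Proof. by case: (GRing.submod_closedB (submodClosedP S)). Qed.

(* An ideal of R is a submodule of the regular module R^o. *)
Notation ideal R := (submodClosed R^o).

Section IdealMulModule.
Variables (R : comPzRingType) (J : ideal R) (N : lmodType R).

Definition ideal_mulmod : {pred N} :=
  [pred x | `[< exists k (j : 'I_k -> R) (n : 'I_k -> N),
      (forall i, j i \in J) /\ x = \sum_(i < k) j i *: n i >]].

Lemma ideal_mul_in j (n : N) : j \in J -> j *: n \in ideal_mulmod.
Proof.
move=> Jj; apply/asboolP; exists 1%N, (fun=> j), (fun=> n).
by split=> //; rewrite big_ord1.
Qed.

Lemma ideal_mulmod_closed : submod_closed ideal_mulmod.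
Proof.
split.
  apply/asboolP; exists 0%N, (fun=> 0), (fun=> 0).
  by split=> [[]//|]; rewrite big_ord0.
move=> a u v /asboolP[k [j [n [Jj ->]]]] /asboolP[k' [j' [n' [Jj' ->]]]].
apply/asboolP; exists (k + k')%N.
exists (fun i => match split i with inl i => a * j i | inr i => j' i end).
exists (fun i => match split i with inl i => n i | inr i => n' i end).
split=> [i|]; first by case: (split i) => l //; exact: (@rpredZ _ R^o J).
rewrite big_split_ord scaler_sumr /=; congr (_ + _); apply: eq_bigr => i _.
  by rewrite -[lshift _ _]/(unsplit (inl i)) unsplitK scalerA.
by rewrite -[rshift _ _]/(unsplit (inr i)) unsplitK.
Qed.

HB.instance Definition _ :=
  GRing.isSubmodClosed.Build R N ideal_mulmod
    (GRing.submod_closed_semi ideal_mulmod_closed).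

End IdealMulModule.

Section AmalgamatedRings.
Variables (R1 R2 : comPzRingType) (f : {rmorphism R1 -> R2}) (J : ideal R2).

Let JM (a b : R2) : b \in J -> a * b \in J.
Proof. exact: (@rpredZ _ R2^o J). Qed.

Definition amalg_ring_pred : {pred R1 * R2} :=
  [pred x | `[< exists r j, j \in J /\ x = (r, f r + j) >]].

Lemma amalg_ring_closed : subring_closed amalg_ring_pred.
Proof.
split.
- by apply/asboolP; exists 1, 0; rewrite rpred0 rmorph1 addr0.
- move=> _ _ /asboolP[r [j [Jj ->]]] /asboolP[s [k [Jk ->]]].
  apply/asboolP; exists (r - s), (j - k); split; first exact: (@submodB _ R2^o J).
  by rewrite rmorphB addrACA -opprD.
- move=> _ _ /asboolP[r [j [Jj ->]]] /asboolP[s [k [Jk ->]]].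
  apply/asboolP; exists (r * s), (f r * k + (f s * j + j * k)); split.
    by rewrite !(@rpredD R2^o J) ?JM.
  congr (_, _); rewrite rmorphM /= mulrDl !mulrDr (mulrC j) -!addrA.
  by [].
Qed.

HB.instance Definition _ :=
  GRing.isSubringClosed.Build (R1 * R2)%type amalg_ring_pred amalg_ring_closed.

Definition amalg_ring := {x : R1 * R2 | x \in amalg_ring_pred}.

HB.instance Definition _ := SubChoice.on amalg_ring.
HB.instance Definition _ :=
  GRing.SubChoice_isSubComPzRing.Build _ _ amalg_ring
    (subringClosedP _).

Definition image_ring_pred : {pred R2} :=
  [pred x | `[< exists r j, j \in J /\ x = f r + j >]].

Lemma image_ring_closed : subring_closed image_ring_pred.
Proof.
have E x : (x \in image_ring_pred) <-> exists r, (r, x) \in amalg_ring_pred.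
  split=> [/asboolP[r [j [Jj ->]]]|[r /asboolP[s [j [Jj [_ ->]]]]]].
    by exists r; apply/asboolP; exists r, j.
  by apply/asboolP; exists s, j.
split.
- by apply/E; exists 1; exact: (rpred1 amalg_ring_pred).
- move=> x y /E[r rx] /E[s sy]; apply/E; exists (r - s).
  exact: (@rpredB _ amalg_ring_pred _ _ rx sy).
- move=> x y /E[r rx] /E[s sy]; apply/E; exists (r * s).
  exact: (@rpredM _ amalg_ring_pred _ _ rx sy).
Qed.

HB.instance Definition _ :=
  GRing.isSubringClosed.Build R2 image_ring_pred image_ring_closed.

Definition image_ring := {x : R2 | x \in image_ring_pred}.

HB.instance Definition _ := SubChoice.on image_ring.
HB.instance Definition _ :=
  GRing.SubChoice_isSubComPzRing.Build _ _ image_ring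
    (subringClosedP _).

End AmalgamatedRings.

(* [{linear M -> N | f \; *:%R}] is the type of R1-linear maps from M to N,
   where r : R1 acts on N as f r. *)
Section AmalgamatedModules.
Variables (R1 R2 : comPzRingType) (f : {rmorphism R1 -> R2}) (J : ideal R2).
Variables (M : lmodType R1) (N : lmodType R2).
Variable phi : {linear M -> N | f \; *:%R}.

Local Notation JN := (@ideal_mulmod R2 J N).

Definition amalg_mod_pred : {pred M * N} :=
  [pred x | `[< exists m n, n \in JN /\ x = (m, phi m + n) >]].

Lemma amalg_mod_zmod_closed : zmod_closed amalg_mod_pred.
Proof.
split; first by apply/asboolP; exists 0, 0; rewrite rpred0 raddf0 addr0.
move=> _ _ /asboolP[m [n [Jn ->]]] /asboolP[m' [n' [Jn' ->]]].
apply/asboolP; exists (m - m'), (n - n'); rewrite rpredB //; split=> //.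
by rewrite raddfB addrACA -opprD.
Qed.

HB.instance Definition _ :=
  GRing.isZmodClosed.Build (M * N)%type amalg_mod_pred amalg_mod_zmod_closed.

Definition amalg_mod := {x : M * N | x \in amalg_mod_pred}.

HB.instance Definition _ := SubChoice.on amalg_mod.
HB.instance Definition _ := [SubChoice_isSubZmodule of amalg_mod by <:].

Lemma amalg_scale_subproof (a : amalg_ring f J) (x : amalg_mod) :
  ((val a).1 *: (val x).1, (val a).2 *: (val x).2) \in amalg_mod_pred.
Proof.
case: a x => [a /= /asboolP[r [j [Jj ->]]]] [x /= /asboolP[m [n [Jn ->]]]] /=.
apply/asboolP; exists (r *: m), (f r *: n + (j *: phi m + j *: n)).
split.
  by apply: rpredD; [exact: rpredZ | rewrite rpredD ?ideal_mul_in].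
by rewrite linearZ_LR /= scalerDl !scalerDr -!addrA.
Qed.

(* The componentwise action; see [amalg_scaleE] for the expanded formula. *)
Definition amalg_scale (a : amalg_ring f J) (x : amalg_mod) : amalg_mod :=
  exist _ ((val a).1 *: (val x).1, (val a).2 *: (val x).2)
    (amalg_scale_subproof a x).

Lemma amalg_scaleA a b x :
  amalg_scale a (amalg_scale b x) = amalg_scale (a * b) x.
Proof. by apply: val_inj; rewrite /= !scalerA. Qed.

Lemma amalg_scale1 : left_id 1 amalg_scale.
Proof. by move=> x; apply: val_inj; rewrite /= !scale1r -surjective_pairing. Qed.

Lemma amalg_scaleDr : right_distributive amalg_scale +%R.
Proof. by move=> a x y; apply: val_inj; rewrite /= !scalerDr. Qed.

Lemma amalg_scaleDl x : {morph amalg_scale^~ x : a b / a + b}.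
Proof. by move=> a b; apply: val_inj; rewrite /= !scalerDl. Qed.

HB.instance Definition _ := GRing.Zmodule_isLmodule.Build (amalg_ring f J)
  amalg_mod amalg_scaleA amalg_scale1 amalg_scaleDr amalg_scaleDl.

Lemma amalg_scaleE (a : amalg_ring f J) (x : amalg_mod) r j m n :
    val a = (r, f r + j) -> val x = (m, phi m + n) ->
  val (a *: x) = (r *: m, phi (r *: m) + f r *: n + j *: phi m + j *: n).
Proof.
move=> /= -> -> /=.
by rewrite linearZ_LR /= scalerDl !scalerDr !addrA.
Qed.

Definition image_mod_pred : {pred N} :=
  [pred y | `[< exists m n, n \in JN /\ y = phi m + n >]].

Lemma image_mod_zmod_closed : zmod_closed image_mod_pred.
Proof.
split; first by apply/asboolP; exists 0, 0; rewrite rpred0 raddf0 addr0.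
move=> _ _ /asboolP[m [n [Jn ->]]] /asboolP[m' [n' [Jn' ->]]].
apply/asboolP; exists (m - m'), (n - n'); rewrite rpredB //; split=> //.
by rewrite raddfB addrACA -opprD.
Qed.

HB.instance Definition _ :=
  GRing.isZmodClosed.Build N image_mod_pred image_mod_zmod_closed.

Definition image_mod := {y : N | y \in image_mod_pred}.

HB.instance Definition _ := SubChoice.on image_mod.
HB.instance Definition _ := [SubChoice_isSubZmodule of image_mod by <:].

Lemma image_scale_subproof (a : image_ring f J) (y : image_mod) :
  val a *: val y \in image_mod_pred.
Proof.
case: a y => [a /= /asboolP[r [j [Jj ->]]]] [y /= /asboolP[m [n [Jn ->]]]] /=.
apply/asboolP; exists (r *: m), (f r *: n + (j *: phi m + j *: n)).
split.
  by apply: rpredD; [exact: rpredZ | rewrite rpredD ?ideal_mul_in].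
by rewrite linearZ_LR /= scalerDl !scalerDr -!addrA.
Qed.

Definition image_scale (a : image_ring f J) (y : image_mod) : image_mod :=
  exist _ (val a *: val y) (image_scale_subproof a y).

Lemma image_scaleA a b y :
  image_scale a (image_scale b y) = image_scale (a * b) y.
Proof. by apply: val_inj; rewrite /= scalerA. Qed.

Lemma image_scale1 : left_id 1 image_scale.
Proof. by move=> y; apply: val_inj; rewrite /= scale1r. Qed.

Lemma image_scaleDr : right_distributive image_scale +%R.
Proof. by move=> a x y; apply: val_inj; rewrite /= scalerDr. Qed.

Lemma image_scaleDl y : {morph image_scale^~ y : a b / a + b}.
Proof. by move=> a b; apply: val_inj; rewrite /= scalerDl. Qed.

HB.instance Definition _ := GRing.Zmodule_isLmodule.Build (image_ring f J)
  image_mod image_scaleA image_scale1 image_scaleDr image_scaleDl.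

Definition amalg_sub (F : {pred M}) : {pred amalg_mod} :=
  [pred x | `[< exists m n,
      [/\ m \in F, n \in JN & val x = (m, phi m + n)] >]].

(* N2 consists of elements of the subtype [image_mod], so membership of
   phi m + n in N2 is membership of the element y with that value. *)
Definition amalg_overline (N2 : {pred image_mod}) : {pred amalg_mod} :=
  [pred x | `[< exists m n, [/\ n \in JN, val x = (m, phi m + n)
      & exists2 y, y \in N2 & val y = phi m + n] >]].

Lemma amalg_sub_closed (F : submodClosed M) : submod_closed (amalg_sub F).
Proof.
have E x : (x \in amalg_sub F) = ((val x).1 \in F).
  apply/asboolP/idP => [[m [n [Fm _ ->]]]//|].
  by case: x => [x /= /asboolP[m [n [Jn ->]]]] Fm; exists m, n.
split=> [|a x y]; first by rewrite E rpred0.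
by rewrite !E /= => Fx Fy; rewrite rpredD ?rpredZ.
Qed.

Lemma amalg_overline_closed (N2 : submodClosed image_mod) :
  submod_closed (amalg_overline N2).
Proof.
have E x : (x \in amalg_overline N2) <->
    exists2 y, y \in N2 & val y = (val x).2.
  split=> [/asboolP[m [n [_ -> [y N2y yE]]]]|]; first by exists y.
  case: x => [x /= xP] [y N2y yE]; apply/asboolP => /=.
  by move: xP yE => /asboolP[m [n [Jn ->]]] yE; exists m, n; split=> //; exists y.
split=> [|a u v]; first by apply/E; exists 0; rewrite ?rpred0.
move=> /E[y N2y yE] /E[z N2z zE]; apply/E.
have aP : (val a).2 \in image_ring_pred f J.
  case: (a) => [b /= /asboolP[r [j [Jj ->]]]].
  by apply/asboolP; exists r, j.
exists ((exist _ (val a).2 aP : image_ring f J) *: y + z); first by rewrite rpredD ?rpredZ.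
by rewrite /= -yE -zE.
Qed.

End AmalgamatedModules.

Arguments ideal_mulmod {R} J N.
Arguments amalg_mod {R1 R2 f} J {M N} phi.
Arguments image_mod {R1 R2 f} J {M N} phi.
Arguments amalg_sub {R1 R2 f} J {M N} phi F.
Arguments amalg_overline {R1 R2 f} J {M N} phi N2.

(* Main.v *)
Require Import Defs.
From HB Require Import structures.
From mathcomp Require Import all_boot all_order all_algebra.
From mathcomp Require Import boolp.
Import GRing.Theory.
Local Open Scope ring_scope.

(** The 2-absorbing property passes both ways along preimages under a
surjective semilinear map: let [g : R -> S] be multiplicative and onto, let
[h : M -> N] be onto with [h (r *: m) = g r *: h m], and let [F] be the
preimage of [G] under [h].  Every instance [a, b, m] of the condition for [F]
then reads as the instance [g a, g b, h m] of the condition for [G], and all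
instances for [G] arise in this way ([two_absorbing_preim]).

Both equivalences are instances of this.  Those elements of the amalgamated
module whose first coordinate lies in [F] form the first submodule, the
preimage of [F] under the first projection onto [M], which is semilinear over
the projection of the amalgamated ring onto [R1].  The second submodule is the
preimage of [N2] under the second projection onto [phi(M) + JN], semilinear
over the projection of the amalgamated ring onto [f(R1) + J]. *)

Section SemilinearPreimage.
Variables (R S : comPzRingType) (M : lmodType R) (N : lmodType S).
Variables (g : R -> S) (h : M -> N).
Hypotheses (gM : {morph g : a b / a * b}) (g_surj : forall s, exists r, g r = s).
Hypotheses (hZ : forall r m, h (r *: m) = g r *: h m).
Hypothesis h_surj : forall n, exists m, h m = n.
Variables (F : {pred M}) (G : {pred N}).
Hypothesis memF : forall m, (m \in F) = (h m \in G).

Lemma colon_preim r : (r \in colon F) = (g r \in colon G).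
Proof.
apply/asboolP/asboolP => [FG n | GF m]; last by rewrite memF hZ.
by have [m <-] := h_surj n; rewrite -hZ -memF.
Qed.

Lemma two_absorbing_preim :
  submod_closed F -> submod_closed G -> two_absorbing F <-> two_absorbing G.
Proof.
move=> Fsub Gsub; split=> -[[_ [x Fx]] absF]; (split; first split=> //).
- by exists (h x); rewrite -memF.
- move=> s t n; have [a <-] := g_surj s; have [b <-] := g_surj t.
  have [m <-] := h_surj n.
  by rewrite -gM -!hZ -!memF -colon_preim; apply: absF.
- by have [m hm] := h_surj x; exists m; rewrite memF hm.
- by move=> a b m; rewrite colon_preim !memF !hZ gM; apply: absF.
Qed.

End SemilinearPreimage.

Section AmalgamProjections.
Variables (R1 R2 : comPzRingType) (f : {rmorphism R1 -> R2}) (J : ideal R2).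
Variables (M : lmodType R1) (N : lmodType R2).
Variable phi : {linear M -> N | f \; *:%R}.

Lemma amalg_ring_snd_in (a : amalg_ring f J) : (val a).2 \in image_ring_pred f J.
Proof. by case: a => [_ /= /asboolP[r [j [Jj ->]]]]; apply/asboolP; exists r, j. Qed.

(** The second projection from the amalgamated ring to [f(R1) + J]. *)
Definition amalg_ring_snd (a : amalg_ring f J) : image_ring f J :=
  exist _ (val a).2 (amalg_ring_snd_in a).

Lemma amalg_mod_snd_in (x : amalg_mod J phi) : (val x).2 \in image_mod_pred J phi.
Proof. by case: x => [_ /= /asboolP[m [n [Jn ->]]]]; apply/asboolP; exists m, n. Qed.

(** The second projection from the amalgamated module to [phi(M) + JN]. *)
Definition amalg_mod_snd (x : amalg_mod J phi) : image_mod J phi :=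
  exist _ (val x).2 (amalg_mod_snd_in x).

Lemma amalg_ring_fst_surj (r : R1) : exists a : amalg_ring f J, (val a).1 = r.
Proof.
have rP : (r, f r) \in amalg_ring_pred f J.
  by apply/asboolP; exists r, 0; rewrite (@rpred0 R2^o J) addr0.
by exists (Sub (r, f r) rP).
Qed.

Lemma amalg_mod_fst_surj (m : M) : exists x : amalg_mod J phi, (val x).1 = m.
Proof.
have mP : (m, phi m) \in amalg_mod_pred J phi.
  by apply/asboolP; exists m, 0; rewrite rpred0 addr0.
by exists (Sub (m, phi m) mP).
Qed.

Lemma amalg_ring_snd_surj (s : image_ring f J) : exists a, amalg_ring_snd a = s.
Proof.
case: (s) (valP s) => [y yP] /asboolP[r [j [Jj /= yE]]].
have aP : (r, y) \in amalg_ring_pred f J by apply/asboolP; exists r, j; rewrite yE.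
by exists (Sub (r, y) aP); apply: val_inj.
Qed.

Lemma amalg_mod_snd_surj (y : image_mod J phi) : exists x, amalg_mod_snd x = y.
Proof.
case: (y) (valP y) => [z zP] /asboolP[m [n [Jn /= zE]]].
have xP : (m, z) \in amalg_mod_pred J phi by apply/asboolP; exists m, n; rewrite zE.
by exists (Sub (m, z) xP); apply: val_inj.
Qed.

Lemma mem_amalg_sub (F : {pred M}) (x : amalg_mod J phi) :
  (x \in amalg_sub J phi F) = ((val x).1 \in F).
Proof.
apply/asboolP/idP => [[m [n [Fm _ ->]]] // | ].
by case: x => [_ /= /asboolP[m [n [Jn ->]]]] Fm; exists m, n.
Qed.

Lemma mem_amalg_overline (N2 : {pred image_mod J phi}) (x : amalg_mod J phi) :
  (x \in amalg_overline J phi N2) = (amalg_mod_snd x \in N2).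
Proof.
apply/asboolP/idP => [[m [n [_ xE [y N2y yE]]]] | N2x].
  suff -> : amalg_mod_snd x = y by [].
  by apply: val_inj; rewrite yE /= xE.
have /asboolP[m [n [Jn xE]]] := valP x.
by exists m, n; split=> //; exists (amalg_mod_snd x); rewrite //= xE.
Qed.

End AmalgamProjections.

Theorem theorem3p1 (R1 R2 : comPzRingType) (f : {rmorphism R1 -> R2})
    (J : ideal R2) (M : lmodType R1) (N : lmodType R2)
    (phi : {linear M -> N | f \; *:%R})
    (F : submodClosed M) (N2 : submodClosed (image_mod J phi)) :
  (@two_absorbing (amalg_ring f J) (amalg_mod J phi) (amalg_sub J phi F) <->
   @two_absorbing R1 M F) /\
  (@two_absorbing (amalg_ring f J) (amalg_mod J phi) (amalg_overline J phi N2) <->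
   @two_absorbing (image_ring f J) (image_mod J phi) N2).
Proof.
split.
- apply: (@two_absorbing_preim (amalg_ring f J) R1 (amalg_mod J phi) M
    (fun a => (val a).1) (fun x => (val x).1)) => //.
  + exact: amalg_ring_fst_surj.
  + exact: amalg_mod_fst_surj.
  + exact: mem_amalg_sub.
  + exact: amalg_sub_closed.
  + exact: submodClosedP.
- apply: (@two_absorbing_preim (amalg_ring f J) (image_ring f J)
    (amalg_mod J phi) (image_mod J phi)
    (@amalg_ring_snd _ _ f J) (@amalg_mod_snd _ _ f J M N phi)).
  + by move=> a b; apply: val_inj.
  + exact: amalg_ring_snd_surj.
  + by move=> a x; apply: val_inj.
  + exact: amalg_mod_snd_surj.
  + exact: mem_amalg_overline.
  + exact: amalg_overline_closed.
  + exact: submodClosedP.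
Qed.
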